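(* There exists an Eulerian oriented planar triangulation $G$ such that for each of the three independent sets $I$ of its tripartition, the induced subgraph $H=G-I$ admits no CAI-partition.
   Context: An oriented graph is a directed graph without directed cycles of length $1$ or $2$. An oriented graph is Eulerian if it is connected and every vertex has in-degree equal to out-degree. A planar triangulation is a (finite, simple) planar graph all of whose faces, including the outer face, are triangles; an oriented planar triangulation is an oriented graph whose underlying undirected graph is a planar triangulation. If $G$ is an Eulerian oriented planar triangulation, its underlying graph has all degrees even, and hence has a unique partition of its vertex set into three independent sets $I_1,I_2,I_3$, called its tripartition. A CAI-partition of an oriented graph $H$ is a partition $V(H)=\mathcal{A}\cup\mathcal{I}$ such that $\mathcal{A}$ induces a connected (in the underlying undirected sense) subdigraph without directed cycles and $\mathcal{I}$ is an independent set. *)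

(* Defs.v *)
From mathcomp Require Import all_boot all_order all_algebra.
From mathcomp Require Import all_classical all_reals all_analysis.
Import numFieldNormedType.Exports.

Set Implicit Arguments.
Unset Strict Implicit.
Unset Printing Implicit Defensive.

(* A finite digraph is a relation [e] on a finType, [e u v] meaning that there
   is an arc from [u] to [v].  An undirected simple graph is a symmetric
   irreflexive relation. *)

Definition underlying (T : finType) (e : rel T) : rel T :=
  [rel u v | e u v || e v u].

(* [ucycleb] requires distinct vertices but accepts the empty sequence. *)
Definition dicycle (T : finType) (e : rel T) (c : seq T) : bool :=
  (c != [::]) && ucycleb e c.

Definition oriented (T : finType) (e : rel T) : Prop :=
  forall c : seq T, dicycle e c -> size c != 1 /\ size c != 2.

Definition acyclic (T : finType) (e : rel T) : Prop :=
  forall c : seq T, ~~ dicycle e c.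

Definition connected_digraph (T : finType) (e : rel T) : Prop :=
  forall u v : T, connect (underlying e) u v.

Definition indegree (T : finType) (e : rel T) (v : T) : nat :=
  #|[pred u | e u v]|.

Definition outdegree (T : finType) (e : rel T) (v : T) : nat :=
  #|[pred u | e v u]|.

Definition eulerian (T : finType) (e : rel T) : Prop :=
  connected_digraph e /\ forall v : T, indegree e v = outdegree e v.

Definition independent (T : finType) (e : rel T) (S : {set T}) : Prop :=
  {in S &, forall u v : T, ~~ underlying e u v}.

Definition induced_digraph (T : finType) (e : rel T) (S : {set T}) :
    rel {x : T | x \in S} :=
  [rel x y | e (val x) (val y)].

Arguments induced_digraph {T} e S.

Definition tripartition (T : finType) (e : rel T) (P : {set {set T}}) : Prop :=
  [/\ finset.partition P [set: T], #|P| = 3 &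
      forall I : {set T}, I \in P -> independent e I].

(* Either part is allowed to be empty. *)
Definition CAI_partition (T : finType) (e : rel T) (A I : {set T}) : Prop :=
  [/\ A :|: I = [set: T], [disjoint A & I],
      connected_digraph (induced_digraph e A), acyclic (induced_digraph e A) &
      independent e I].

Local Open Scope classical_set_scope.
Local Open Scope ring_scope.

Definition plane (R : realType) : topologicalType := (R * R)%type.

Definition arc_between (R : realType) (a b : plane R) (C : set (plane R)) :
    Prop :=
  exists f : R -> plane R,
    [/\ {within `[0, 1], continuous f}, {in `[0, 1] &, injective f},
        f 0 = a, f 1 = b & f @` `[0, 1] = C].

(* [p] places the vertices of the undirected graph [g] in the plane and
   [C u v] is the (unoriented) curve representing the edge [uv]; the value of
   [C] on pairs of non-adjacent vertices is irrelevant. *)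
Definition plane_drawing (R : realType) (T : finType) (g : rel T)
    (p : T -> plane R) (C : T -> T -> set (plane R)) : Prop :=
  [/\ injective p,
      forall u v, g u v -> arc_between (p u) (p v) (C u v) /\ C u v = C v u,
      forall u v w, g u v -> C u v (p w) -> w = u \/ w = v &
      forall u v x y, g u v -> g x y ->
        [set u; v] <> [set x; y] ->
        C u v `&` C x y `<=` p @` ([set u; v] `&` [set x; y])].

Definition drawing_support (R : realType) (T : finType) (g : rel T)
    (p : T -> plane R) (C : T -> T -> set (plane R)) : set (plane R) :=
  range p `|` [set z | exists u v, g u v /\ C u v z].

Definition drawing_face (R : realType) (T : finType) (g : rel T)
    (p : T -> plane R) (C : T -> T -> set (plane R)) (F : set (plane R)) :
    Prop :=
  exists2 z, (~` drawing_support g p C) z &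
    F = connected_component (~` drawing_support g p C) z.

Definition frontier (R : realType) (F : set (plane R)) : set (plane R) :=
  closure F `\` F^°.

Definition triangular_face (R : realType) (T : finType) (g : rel T)
    (C : T -> T -> set (plane R)) (F : set (plane R)) : Prop :=
  exists u v w : T, [/\ g u v, g v w, g w u &
    frontier F = C u v `|` C v w `|` C w u].

(* The unbounded face is one of the [drawing_face]s. *)
Definition planar_triangulation (R : realType) (T : finType) (g : rel T) :
    Prop :=
  [/\ symmetric g, irreflexive g &
      exists (p : T -> plane R) (C : T -> T -> set (plane R)),
        plane_drawing g p C /\
        forall F, drawing_face g p C F -> triangular_face g C F].

Definition oriented_planar_triangulation (R : realType) (T : finType)
    (e : rel T) : Prop :=
  oriented e /\ planar_triangulation R (underlying e).

(* Main.v *)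
Require Import Defs.
From mathcomp Require Import all_boot all_order all_algebra.
From mathcomp Require Import all_classical all_reals all_analysis.
From mathcomp Require Import ring lra ssrZ.
From Stdlib Require ZArith.
Import Order.TTheory GRing.Theory Num.Theory numFieldNormedType.Exports.

(** Three copies of one gadget, one for each class of the tripartition, are
    glued together, and the copy belonging to a class prevents CAI-partitions
    once that class is removed.

    The core of the gadget has vertices c_i, d_i, s_i, with i modulo 4, and
    arcs c_i -> c_(i+1), c_i -> d_i -> c_(i+2) and d_i -> s_i <- c_(i+1).  An
    oriented graph H which contains the core in such a way that s_i has no
    other neighbours than d_i and c_(i+1) has no CAI-partition A, J
    ([no_CAI_partition]).  Indeed the directed square of the c_i meets J, say
    in c_0, so that the neighbours c_1, c_3 and s_3 of c_0 are in A.  Since A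
    is connected, s_3 has a neighbour in A, which can only be d_3.  The
    directed square c_1 d_1 c_3 d_3 is not contained in A, so d_1 is in J.
    If c_2 were in J, then s_1 would be in A without a neighbour in A; so c_2
    is in A, and now c_1 c_2 c_3 d_3 is a directed square inside A.

    The core is a plane quadrangulation, with faces c_i d_i s_i c_(i+1) and
    d_i s_i c_(i+1) c_(i+2) for all i, and c_i d_i c_(i+2) d_(i+2) for i = 0
    and 1.  An apex placed in each face and joined to its four corners gives
    a triangulation on 22 vertices whose parts are the set of apexes and the
    two colour classes of the core.  Each apex sends arcs to two of its
    corners and receives arcs from the other two; it is chosen which ones so
    that every core vertex receives as many arcs from apexes as it sends into
    the core, which makes the gadget Eulerian.

    Two Eulerian oriented triangulations glued along a directed facial
    triangle are again an Eulerian oriented triangulation, because a directed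
    triangle is itself balanced.  The second and the third copy are glued in
    this way to the first one, with the three parts permuted so that every
    part of the resulting graph on 60 vertices is the apex part of one copy.
    The gluing triangles avoid the s_i, whose neighbours do not change.

    The resulting graph is drawn with straight edges and integer coordinates.
    That this is a drawing all of whose faces are triangles follows from the
    signs of finitely many determinants ([drawing_checkP]).  The delicate
    point is that no face has been overlooked: crossing numbers of a
    horizontal ray with the sides of the listed triangles cancel along inner
    edges, so that a point off the edges which lies inside the outer triangle
    lies inside a listed one ([face_cover]).  The open triangles and the
    outside of the outer triangle are connected, open and bounded by edges,
    and are therefore the faces.  Finally, two vertices facing each other
    across an edge belong to the same part of any tripartition, and spreading
    this from one triangle determines all the parts ([tripartition_list]). *)

Set Implicit Arguments.
Unset Strict Implicit.
Unset Printing Implicit Defensive.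

Local Notation Z := BinNums.Z.

(** * Orientation of triples and crossing numbers *)

Local Open Scope ring_scope.

(** Twice the signed area of the triangle [a b c], positive when it is
    counterclockwise; as a function of [c] it vanishes on the line [ab]. *)
Definition det (R : realDomainType) (a b c : R * R) : R :=
  (b.1 - a.1) * (c.2 - a.2) - (b.2 - a.2) * (c.1 - a.1).

Definition inside (R : realDomainType) (a b c z : R * R) : bool :=
  [&& 0 < det a b z, 0 < det b c z & 0 < det c a z].

Definition covers (R : realDomainType) (a b c z : R * R) : bool :=
  [&& 0 <= det a b z, 0 <= det b c z & 0 <= det c a z].

(** The side [ab] crosses upwards the horizontal ray that starts in [z] and
    points to the right.  The half-open condition on heights treats a vertex
    at the height of [z] as lying below the ray. *)
Definition upcross (R : realDomainType) (a b z : R * R) : bool :=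
  [&& a.2 <= z.2, z.2 < b.2 & 0 < det a b z].

Definition crossing (R : realDomainType) (a b z : R * R) : int :=
  (upcross a b z)%:Z - (upcross b a z)%:Z.

Lemma det_swap (R : realDomainType) (a b z : R * R) : det b a z = - det a b z.
Proof. rewrite /det; ring. Qed.

Lemma det_rot (R : realDomainType) (a b c : R * R) : det b c a = det a b c.
Proof. rewrite /det; ring. Qed.

Lemma det_sum (R : realDomainType) (a b c z : R * R) :
  det a b z + det b c z + det c a z = det a b c.
Proof. rewrite /det; ring. Qed.

(** The determinants of [z] with the sides are its barycentric coordinates, up
    to the factor [det a b c]; so the heights of the vertices above [z] have
    weighted sum zero. *)
Lemma det_moment (R : realDomainType) (a b c z : R * R) :
  det b c z * (a.2 - z.2) + det c a z * (b.2 - z.2) + det a b z * (c.2 - z.2) = 0.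
Proof. rewrite /det; ring. Qed.

(** The winding number of a triangle around a point off its boundary.  With
    the signs of the barycentric coordinates and of the three heights above
    [z] fixed, either both sides of the equation agree or the hypotheses
    contradict [det_sum] and [det_moment]. *)
Lemma crossing_triangle (R : realFieldType) (a b c z : R * R) :
  0 < det a b c -> (covers a b c z -> inside a b c z) ->
  crossing a b z + crossing b c z + crossing c a z = (inside a b c z)%:Z.
Proof.
rewrite /crossing /upcross /covers /inside (det_swap a b) (det_swap b c) (det_swap c a).
have := det_sum a b c z; have := det_moment a b c z.
(* three vertices at the same height are collinear *)
have flat : a.2 = z.2 -> b.2 = z.2 -> c.2 = z.2 -> det a b c = 0.
  by rewrite /det => -> -> ->; ring.
move: flat.
move: (det a b c) (det a b z) (det b c z) (det c a z) => D lc la lb.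
have E (x y : R) : (x <= y) = ~~ (0 < x - y) by rewrite subr_gt0 leNgt.
have E' (x y : R) : (x < y) = (0 < y - x) by rewrite subr_gt0.
rewrite ![_.2 <= _]E ![_ < _.2]E' !oppr_gt0.
have E0 (x y : R) : x - y = 0 -> x = y by move/eqP; rewrite subr_eq0 => /eqP.
move=> /(fun f u v w => f (E0 _ _ u) (E0 _ _ v) (E0 _ _ w)).
move: (a.2 - z.2) (b.2 - z.2) (c.2 - z.2) => ya yb yc {E E' E0} flat mom sum D0.
case: (ltrgtP 0 la) => la0; case: (ltrgtP 0 lb) => lb0;
case: (ltrgtP 0 lc) => lc0 //=; try (by move=> /(_ isT));
move=> _; case: (ltrP 0 ya) => ya0; case: (ltrP 0 yb) => yb0;
case: (ltrP 0 yc) => yc0 //=; exfalso; nra.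
Qed.

(** * Segments, and connected open sets of the plane *)

Local Open Scope classical_set_scope.

Definition lin (R : realType) (a b : plane R) (t : R) : plane R :=
  (a.1 + t * (b.1 - a.1), a.2 + t * (b.2 - a.2)).

Definition segment (R : realType) (a b : plane R) : set (plane R) :=
  lin a b @` `[0, 1].

Lemma det_lin (R : realType) (a b x y : plane R) (t : R) :
  det a b (lin x y t) = (1 - t) * det a b x + t * det a b y.
Proof. rewrite /det /lin /=; ring. Qed.

Lemma lin_continuous (R : realType) (a b : plane R) : continuous (lin a b).
Proof.
move=> t; apply: (@cvg_pair _ _ _ _ (nbhs (a.1 + t * (b.1 - a.1)))
  (nbhs (a.2 + t * (b.2 - a.2)))).
- by apply: cvgD; [exact: cvg_cst|apply: cvgM; [exact: cvg_id|exact: cvg_cst]].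
- by apply: cvgD; [exact: cvg_cst|apply: cvgM; [exact: cvg_id|exact: cvg_cst]].
Qed.

Lemma det_continuous (R : realType) (a b : plane R) :
  continuous (det a b : plane R -> R).
Proof.
move=> z; apply: cvgB; apply: cvgM; try exact: cvg_cst;
  by apply: cvgB; [first [exact: cvg_snd|exact: cvg_fst]|exact: cvg_cst].
Qed.

Lemma segment_arc (R : realType) (a b : plane R) :
  a != b -> arc_between a b (segment a b).
Proof.
move=> ab; exists (lin a b); split => //.
- by apply: continuous_subspaceT => t; exact: lin_continuous.
- move=> s t _ _ [/addrI e1 /addrI e2]; apply/eqP; rewrite -subr_eq0.
  apply: contraNT ab => st; apply/eqP.
  have cancel (x : R) : s * x = t * x -> x = 0.
    move/eqP; rewrite -subr_eq0 -mulrBl mulf_eq0 (negPf st) /=.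
    by move/eqP.
  rewrite [LHS]surjective_pairing [RHS]surjective_pairing.
  by congr pair; apply/esym/eqP; rewrite -subr_eq0; apply/eqP; exact: cancel.
- by rewrite /lin !mul0r !addr0 -surjective_pairing.
- by rewrite /lin !mul1r ![_ + (_ - _)]addrC !subrK -surjective_pairing.
Qed.

Lemma lin_rev (R : realType) (a b : plane R) (t : R) :
  lin b a (1 - t) = lin a b t.
Proof. by rewrite /lin; congr pair; ring. Qed.

Lemma segmentC (R : realType) (a b : plane R) : segment a b = segment b a.
Proof.
suff sub (x y : plane R) : segment x y `<=` segment y x.
  by apply/seteqP; split; exact: sub.
move=> _ [t /= t01 <-]; exists (1 - t); last exact: lin_rev.
by move: t01; rewrite /= !in_itv /=; lra.
Qed.

Lemma segment_end (R : realType) (a b : plane R) : segment a b a.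
Proof.
exists 0; first by rewrite /= in_itv /= lexx ler01.
by rewrite /lin !mul0r !addr0 -surjective_pairing.
Qed.

Lemma det_self (R : realDomainType) (a b : R * R) : (det a b a = 0) * (det a b b = 0).
Proof. by split; rewrite /det; ring. Qed.

(** The line [ab] leaves [x] and [y] strictly on the same side. *)
Lemma segment_sep (R : realType) (a b x y : plane R) :
  0 < det a b x * det a b y -> segment a b `&` segment x y = set0.
Proof.
move=> pos; apply/seteqP; split=> // z [[s _ <-] [t + /esym e]].
have : det a b (lin a b s) = 0 by rewrite det_lin !det_self; ring.
rewrite e det_lin /= in_itv /= {e}.
move: (det a b x) (det a b y) pos => u v + e0 /andP[t0 t1].
have [u0|u0|<-] := ltrgtP 0 u; last by rewrite mul0r ltxx.
  by rewrite pmulr_rgt0 // => v0; nra.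
by rewrite nmulr_rgt0 // => v0; nra.
Qed.

Lemma segment_fork (R : realType) (k a b : plane R) :
  det k a b != 0 -> segment k a `&` segment k b `<=` [set k].
Proof.
move=> kab z [[s _ es] [t _ et]].
have : det k b z = 0 by rewrite -et det_lin !det_self; ring.
rewrite -es det_lin det_self mulr0 add0r => /eqP; rewrite mulf_eq0.
have -> : det k b a = - det k a b by rewrite /det; ring.
rewrite oppr_eq0 (negPf kab) orbF => /eqP ->.
by rewrite /lin !mul0r !addr0 -surjective_pairing.
Qed.

(** The component of [z] cannot leave [F]: its trace on [F] is relatively open,
    and also relatively closed as the boundary of [F] lies in [S]. *)
Lemma connected_component_open (X : topologicalType) (S F : set X) (z : X) :
  open F -> connected F -> F `&` S = set0 -> closure F `\` F `<=` S -> F z ->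
  connected_component (~` S) z = F.
Proof.
move=> oF cF FS clF Fz; have FC : F `<=` ~` S.
  by move=> x Fx Sx; have : (F `&` S) x by []; rewrite FS.
apply/seteqP; split; last first.
  by apply: connected_component_max.
have KU : connected_component (~` S) z `<=` ~` S := @connected_component_sub _ _ z.
have Kz : connected_component (~` S) z z by apply: connected_component_refl; exact: FC.
have Kc : connected (connected_component (~` S) z) := @component_connected _ _ _.
have e : connected_component (~` S) z `&` F = connected_component (~` S) z.
  apply: Kc.
  - by exists z.
  - by exists F.
  - exists (closure F); first exact: closed_closure.
    apply/seteqP; split => x [Kx Fx]; split => //.
      exact: subset_closure.
    by apply: contrapT => nF; apply: (KU _ Kx); apply: clF.
by rewrite -e => x [].
Qed.

(** A convex set is the union of the segments from one of its points. *)
Lemma convex_connected (R : realType) (A : set (plane R)) :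
  (forall x y (t : R), A x -> A y -> 0 <= t <= 1 -> A (lin x y t)) -> connected A.
Proof.
move=> cvx; have [->|/set0P[x Ax]] := eqVneq A set0; first exact: connected0.
have -> : A = \bigcup_(y in A) segment x y.
  apply/seteqP; split=> [y Ay|z [y Ay [t t01 <-]]].
    by exists y => //; rewrite segmentC; exact: segment_end.
  by apply: cvx => //; move: t01; rewrite /= in_itv.
apply: bigcup_connected.
  by exists x => y _; exact: segment_end.
move=> y _; apply: connected_continuous_connected; first exact: segment_connected.
by apply: continuous_subspaceT => t; exact: lin_continuous.
Qed.

Lemma closure_along (R : realType) (A : set (plane R)) (z w : plane R) :
  (forall t : R, 0 < t <= 1 -> A (lin z w t)) -> closure A z.
Proof.
move=> hA B; rewrite -[z in nbhs z]/(z : plane R) => Bz.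
have : nbhs (0 : R) (lin z w @^-1` B).
  apply: lin_continuous; rewrite /lin !mul0r !addr0.
  by case: (z) Bz.
move=> /nbhs_ballP[d /= d0 hd].
pose t := Num.min 1 (d / 2).
have t0 : 0 < t by rewrite lt_min ltr01 divr_gt0.
have t1 : t <= 1 by rewrite ge_min lexx.
exists (lin z w t); split; first by apply: hA; rewrite t0.
apply: hd; rewrite /ball /= sub0r normrN gtr0_norm //.
by rewrite gt_min; apply/orP; right; rewrite ltr_pdivrMr // ltr_pMr // ltr1n.
Qed.

(** * The inside and the outside of a triangle *)

Definition interior_triangle (R : realType) (a b c : plane R) : set (plane R) :=
  [set z | inside a b c z].
Definition exterior_triangle (R : realType) (a b c : plane R) : set (plane R) :=
  [set z | ~~ covers a b c z].

Definition centroid (R : realType) (a b c : plane R) : plane R :=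
  ((a.1 + b.1 + c.1) / 3%:R, (a.2 + b.2 + c.2) / 3%:R).

Lemma det_centroid (R : realType) (a b c : plane R) :
  det a b (centroid a b c) = det a b c / 3%:R.
Proof. by rewrite /det /centroid /=; field. Qed.

Lemma inside_centroid (R : realType) (a b c : plane R) :
  0 < det a b c -> inside a b c (centroid a b c).
Proof.
move=> D0.
have rot (x y z : plane R) : centroid x y z = centroid y z x.
  by rewrite /centroid; congr (_ / _, _ / _); ring.
have pos : 0 < det a b c / 3%:R by rewrite divr_gt0 // ltr0n.
rewrite /inside det_centroid pos (rot a) det_centroid det_rot pos.
by rewrite (rot b) det_centroid det_rot det_rot pos.
Qed.

Lemma open_halfplane (R : realType) (a b : plane R) :
  open [set z : plane R | 0 < det a b z].
Proof.
apply: (@open_comp _ _ (det a b : plane R -> R) [set x : R | 0 < x]).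
  by move=> z _; exact: det_continuous.
exact: open_gt.
Qed.

Lemma closed_halfplane (R : realType) (a b : plane R) :
  closed [set z : plane R | 0 <= det a b z].
Proof.
apply: (@closed_comp _ _ (det a b : plane R -> R) [set x : R | 0 <= x]).
  by move=> z _; exact: det_continuous.
exact: closed_ge.
Qed.

Lemma interior_triangle_open (R : realType) (a b c : plane R) :
  open (interior_triangle a b c).
Proof.
have -> : interior_triangle a b c = [set z | 0 < det a b z] `&`
    ([set z | 0 < det b c z] `&` [set z | 0 < det c a z]).
  by apply/seteqP; split => z /=; [case/and3P|case=> ? [? ?]; apply/and3P].
by do ![apply: openI]; exact: open_halfplane.
Qed.

Lemma exterior_triangle_open (R : realType) (a b c : plane R) :
  open (exterior_triangle a b c).
Proof.
have -> : exterior_triangle a b c = ~` ([set z | 0 <= det a b z] `&`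
    ([set z | 0 <= det b c z] `&` [set z | 0 <= det c a z])).
  apply/seteqP; split => z /=; first by move=> /negP n [? [? ?]]; apply: n; apply/and3P.
  by move=> n; apply/negP => /and3P[? ? ?]; apply: n.
rewrite openC; by do ![apply: closedI]; exact: closed_halfplane.
Qed.

Lemma interior_triangle_connected (R : realType) (a b c : plane R) :
  connected (interior_triangle a b c).
Proof.
apply: convex_connected => x y t /and3P[x1 x2 x3] /and3P[y1 y2 y3] t01.
rewrite /interior_triangle /= /inside !det_lin.
have pos (u v : R) : 0 < u -> 0 < v -> 0 < (1 - t) * u + t * v.
  by move=> u0 v0; case/andP: t01 => t0 t1; nra.
by rewrite !pos.
Qed.

Lemma halfplane_connected (R : realType) (a b : plane R) :
  connected [set z : plane R | det a b z < 0].
Proof.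
apply: convex_connected => x y t /= x0 y0 /andP[t0 t1]; rewrite det_lin.
by move: (det a b x) (det a b y) x0 y0 => u v u0 v0; nra.
Qed.

(** The outside is the union of three open half-planes, two of which meet
    behind each vertex of the triangle. *)
Lemma exterior_triangle_connected (R : realType) (a b c : plane R) :
  0 < det a b c -> connected (exterior_triangle a b c).
Proof.
move=> D0.
have meet (x y z : plane R) : 0 < det x y z ->
    [set p | det x y p < 0] `&` [set p | det y z p < 0] !=set0.
  (* barycentric coordinates -1, 3, -1: behind y *)
  move=> D1; exists (3 * y.1 - x.1 - z.1, 3 * y.2 - x.2 - z.2).
  split=> /=.
    suff -> : det x y (3 * y.1 - x.1 - z.1, 3 * y.2 - x.2 - z.2) = - det x y z.
      by rewrite oppr_lt0.
    by rewrite /det /=; ring.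
  suff -> : det y z (3 * y.1 - x.1 - z.1, 3 * y.2 - x.2 - z.2) = - det x y z.
    by rewrite oppr_lt0.
  by rewrite /det /=; ring.
have -> : exterior_triangle a b c = [set z | det a b z < 0] `|`
    [set z | det b c z < 0] `|` [set z | det c a z < 0].
  apply/seteqP; split=> z; rewrite /exterior_triangle /covers /= !negb_and -!ltNge.
    by case/or3P; [left; left|left; right|right].
  by case=> [[|]|] ->; rewrite ?orbT.
apply: connectedU; last exact: halfplane_connected.
  have [p [p1 p2]] := meet b c a (ltac:(by rewrite det_rot)).
  by exists p; split=> //; right.
by apply: connectedU; [exact: meet|exact: halfplane_connected..].
Qed.

(** Boundary points are approached from inside along the segment that joins
    them to the centroid. *)
Lemma closure_interior_triangle (R : realType) (a b c : plane R) :
  0 < det a b c ->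
  closure (interior_triangle a b c) = [set z | covers a b c z].
Proof.
move=> D0; apply/seteqP; split.
  have -> : [set z | covers a b c z] = [set z | 0 <= det a b z] `&`
    ([set z | 0 <= det b c z] `&` [set z | 0 <= det c a z]).
    by apply/seteqP; split => z /=; [case/and3P|case=> ? [? ?]; apply/and3P].
  rewrite [X in _ `<=` X](_ : _ = closure ([set z | 0 <= det a b z] `&`
    ([set z | 0 <= det b c z] `&` [set z | 0 <= det c a z]))).
    apply: closure_subset => z /and3P[h1 h2 h3].
    by split; [exact: ltW|split; exact: ltW].
  apply: (closure_id _).1; do ![apply: closedI]; exact: closed_halfplane.
move=> z /and3P[z1 z2 z3]; apply: (@closure_along _ _ z (centroid a b c)).
move=> t /andP[t0 t1]; have /and3P[m1 m2 m3] := inside_centroid D0.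
rewrite /interior_triangle /= /inside !det_lin.
have pos (u v : R) : 0 <= u -> 0 < v -> 0 < (1 - t) * u + t * v.
  by move=> u0 v0; nra.
by rewrite !pos.
Qed.

(** Boundary points are approached from outside along the ray that comes from
    the centroid and passes through them. *)
Lemma closure_exterior_triangle (R : realType) (a b c : plane R) :
  0 < det a b c ->
  closure (exterior_triangle a b c) = [set z | ~~ inside a b c z].
Proof.
move=> D0; apply/seteqP; split.
  have cl : closed [set z : plane R | ~~ inside a b c z].
    have -> : [set z : plane R | ~~ inside a b c z] = ~` interior_triangle a b c.
      by apply/seteqP; split=> z /= /negP.
    by rewrite closedC; exact: interior_triangle_open.
  rewrite [X in _ `<=` X](closure_id _).1 //; apply: closure_subset => z /=.
  by apply: contra => /and3P[h1 h2 h3]; apply/and3P; split; exact: ltW.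
move=> z /= nz; have /and3P[m1 m2 m3] := inside_centroid D0.
pose w : plane R := lin (centroid a b c) z 2.
apply: (@closure_along _ _ z w) => t /andP[t0 t1].
(* a nonpositive coordinate of z becomes negative away from the centroid *)
rewrite /exterior_triangle /= /covers /w !det_lin.
have neg (u v : R) : 0 < v -> u <= 0 ->
    (0 <= (1 - t) * u + t * ((1 - 2) * v + 2 * u)) = false.
  by move=> v0 u0; apply/negbTE; rewrite -ltNge; nra.
move: nz; rewrite /inside !negb_and -!leNgt.
by case/or3P => u0; [rewrite (neg _ _ m1 u0)|rewrite (neg _ _ m2 u0)|
  rewrite (neg _ _ m3 u0)]; rewrite ?orbT.
Qed.

Lemma open_frontier (R : realType) (F : set (plane R)) :
  open F -> frontier F = closure F `\` F.
Proof.
move=> oF; rewrite /frontier.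
by rewrite ((interior_id F).1 oF).
Qed.

Lemma triangle_side (R : realType) (a b c : plane R) (z : plane R) :
  0 < det a b c -> covers a b c z -> det a b z = 0 -> segment a b z.
Proof.
move=> D0 /and3P[z1 z2 z3] z0; have := det_sum a b c z; rewrite z0 add0r => s.
(* the barycentric coordinate of z with respect to b *)
exists (det c a z / det a b c).
  rewrite /= in_itv /= divr_ge0 ?(ltW D0) //= ler_pdivrMr // mul1r.
  by rewrite -s lerDr.
have Dn : det a b c != 0 by rewrite gt_eqF.
rewrite /lin [RHS]surjective_pairing; congr pair; apply: (mulfI Dn).
  rewrite mulrDr mulrA mulrCA mulfV // mulr1.
  have : z.1 * det a b c = det b c z * a.1 + det c a z * b.1 + det a b z * c.1.
    by rewrite /det; ring.
  by rewrite z0 mulrC => ->; rewrite -s; ring.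
rewrite mulrDr mulrA mulrCA mulfV // mulr1.
have : z.2 * det a b c = det b c z * a.2 + det c a z * b.2 + det a b z * c.2.
  by rewrite /det; ring.
by rewrite z0 mulrC => ->; rewrite -s; ring.
Qed.

Lemma segment_side (R : realType) (a b c : plane R) (z : plane R) :
  0 < det a b c -> segment a b z -> covers a b c z /\ det a b z = 0.
Proof.
move=> D0 [t + <-]; rewrite /= in_itv /= => /andP[t0 t1].
have e : det a b (lin a b t) = 0 by rewrite det_lin !det_self; ring.
split => //; rewrite /covers e lexx /= !det_lin !det_self.
rewrite (det_rot b c a) (det_rot a b c).
by move: (det a b c) D0 => D D0; apply/andP; split; nra.
Qed.

Lemma triangle_boundary (R : realType) (a b c : plane R) :
  0 < det a b c ->
  [set z | covers a b c z /\ ~~ inside a b c z] =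
  segment a b `|` segment b c `|` segment c a.
Proof.
have rot (x y w p : plane R) : covers x y w p = covers y w x p.
  by rewrite /covers andbC -andbA.
have roti (x y w p : plane R) : inside x y w p = inside y w x p.
  by rewrite /inside andbC -andbA.
move=> D0; have D1 : 0 < det b c a by rewrite det_rot.
have D2 : 0 < det c a b by rewrite det_rot.
apply/seteqP; split => z /=.
  move=> [cz]; rewrite /inside !negb_and -!leNgt; have /and3P[z1 z2 z3] := cz.
  case/or3P => h.
  - by left; left; apply: (triangle_side D0) => //; apply: le_anti; rewrite h.
  - left; right; apply: (triangle_side D1); first by rewrite -rot.
    by apply: le_anti; rewrite h.
  - right; apply: (triangle_side D2); first by rewrite rot.
    by apply: le_anti; rewrite h.
case=> [[|]|] h.
- have [cz z0] := segment_side D0 h.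
  by split=> //; rewrite /inside z0 ltxx.
- have [cz z0] := segment_side D1 h.
  by rewrite rot roti; split=> //; rewrite /inside z0 ltxx.
- have [cz z0] := segment_side D2 h.
  by rewrite -rot -roti; split=> //; rewrite /inside z0 ltxx.
Qed.

(** * Certificates for straight-line drawings *)

(** Coordinates are binary integers, so that the signs of determinants can be
    computed, and are mapped into the real numbers by a ring morphism. *)
Definition embed (R : realType) : Z -> R := intr \o int_of_Z.
Definition embed_point (R : realType) (a : Z * Z) : plane R :=
  (embed R a.1, embed R a.2).

Lemma embed_gt0 (R : realType) (z : Z) : (0 < embed R z) = (0 < z).
Proof.
rewrite /embed /= ltr0z; case: z => [|k|k] //=.
by rewrite ltz_nat; apply/ssrnat.ltP; exact: Pnat.Pos2Nat.is_pos.
Qed.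

Lemma det_embed (R : realType) (a b c : Z * Z) :
  det (embed_point R a) (embed_point R b) (embed_point R c) =
  embed R (det a b c).
Proof. by rewrite /det /embed_point /= /embed !(rmorphB, rmorphM). Qed.
Definition orientation (pos : nat -> Z * Z) (u v w : nat) : Z :=
  det (pos u) (pos v) (pos w).

Definition flip (d : nat * nat) : nat * nat := (d.2, d.1).

Definition sides (t : nat * nat * nat) : seq (nat * nat) :=
  [:: t.1; (t.1.2, t.2); (t.2, t.1.1)].

(** For disjoint segments on two lines that meet, the common point of the lines
    misses one of the segments, which therefore lies strictly on one side of
    the other line.  Hence the last test. *)
Definition disjoint_or_fork (pos : nat -> Z * Z) (d d' : nat * nat) : bool :=
  let o := orientation pos in
  let: (u, v) := d in let: (x, y) := d' in
  if u == x then (v == y) || (o u v y != 0)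
  else if u == y then (v == x) || (o u v x != 0)
  else if v == x then o v u y != 0
  else if v == y then o v u x != 0
  else (0 < o u v x * o u v y) || (0 < o x y u * o x y v).

(** A segment that misses an open triangle is separated from it by the line
    through a side of the triangle or through the segment.  In the second case
    the orientations must not all vanish, as they do for equal endpoints. *)
Definition avoids (pos : nat -> Z * Z) (t : nat * nat * nat) (d : nat * nat) :
    bool :=
  let o := orientation pos in
  has (fun s => (o s.1 s.2 d.1 <= 0) && (o s.1 s.2 d.2 <= 0)) (sides t)
  || (let s := [seq o d.1 d.2 s.1 | s <- sides t] in
      has (fun x => x != 0) s &&
      (all (fun x => x <= 0) s || all (fun x => 0 <= x) s)).

Definition contains (pos : nat -> Z * Z) (t : nat * nat * nat) (w : nat) :
    bool :=
  all (fun s => 0 <= orientation pos s.1 s.2 w) (sides t).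

(** Every inner edge bounds two counterclockwise triangles and occurs once in
    each direction; reversing the outer triangle makes this true of all
    edges. *)
Definition face_darts (faces : seq (nat * nat * nat))
    (outer : nat * nat * nat) : seq (nat * nat) :=
  flatten [seq sides t | t <- faces] ++ [seq flip s | s <- sides outer].

Definition drawing_check (n : nat) (pos : nat -> Z * Z) (E : seq (nat * nat))
    (faces : seq (nat * nat * nat)) (outer : nat * nat * nat) : bool :=
  [&& uniq [seq pos i | i <- iota 0 n],
      all (fun i => has (fun d => d.1 == i) E) (iota 0 n),
      all (fun d => [&& (d.1 < n)%N, (d.2 < n)%N, d.1 != d.2 & flip d \in E]) E,
      all (fun t => (0 < orientation pos t.1.1 t.1.2 t.2) &&
                    all [in E] (sides t)) (outer :: faces),
      uniq (face_darts faces outer) &&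
        all (fun d => flip d \in face_darts faces outer)
            (face_darts faces outer),
      allrel (disjoint_or_fork pos) E E &
      all (fun d => contains pos outer d.1 &&
                    all (fun t => avoids pos t d) faces) E].

Definition place (R : realType) (pos : nat -> Z * Z) (i : nat) : plane R :=
  embed_point R (pos i).

Lemma det_place (R : realType) pos u v w :
  det (place R pos u) (place R pos v) (place R pos w) = embed R (orientation pos u v w).
Proof. exact: det_embed. Qed.

Lemma embed_ge0 (R : realType) (z : Z) : (0 <= embed R z) = (0 <= z).
Proof.
rewrite !leNgt; congr (~~ _); rewrite -oppr_gt0 -[RHS]oppr_gt0.
by rewrite -(embed_gt0 R) /embed rmorphN.
Qed.

Lemma embed_le0 (R : realType) (z : Z) : (embed R z <= 0) = (z <= 0).
Proof. by rewrite !leNgt embed_gt0. Qed.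

Lemma embed_eq0 (R : realType) (z : Z) : (embed R z == 0) = (z == 0).
Proof. by rewrite !eq_le embed_ge0 embed_le0. Qed.

Lemma embed_point_inj (R : realType) : injective (embed_point R).
Proof.
move=> [a1 a2] [b1 b2] [] /intr_inj /(can_inj int_of_ZK) ->.
by move=> /intr_inj /(can_inj int_of_ZK) ->.
Qed.

Lemma disjoint_or_forkP (R : realType) (pos : nat -> Z * Z) (u v x y : nat) :
  disjoint_or_fork pos (u, v) (x, y) -> (u, v) <> (x, y) -> (u, v) <> (y, x) ->
  segment (place R pos u) (place R pos v) `&` segment (place R pos x) (place R pos y) `<=`
  place R pos @` ([set u; v] `&` [set x; y]).
Proof.
have fork k a b : orientation pos k a b != 0 ->
    segment (place R pos k) (place R pos a) `&` segment (place R pos k) (place R pos b)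
    `<=` [set place R pos k].
  by move=> ok; apply: segment_fork; rewrite det_place embed_eq0.
have sep a b c d : 0 < orientation pos a b c * orientation pos a b d ->
    segment (place R pos a) (place R pos b) `&` segment (place R pos c) (place R pos d)
    = set0.
  by move=> ok; apply: segment_sep; rewrite !det_place -rmorphM embed_gt0.
rewrite /disjoint_or_fork.
have [<- + n1 _|] := eqVneq u x.
  have [vy|_ /= o] := eqVneq v y; first by case: n1; rewrite vy.
  by move=> z /(fork _ _ _ o) ->; exists u => //; split; left.
have [<- _ + _ n2|] := eqVneq u y.
  have [vx|_ /= o] := eqVneq v x; first by case: n2; rewrite vx.
  rewrite (segmentC (place R pos x)) => z /(fork _ _ _ o) ->.
  by exists u => //; split; [left|right].
have [<- _ _ o _ _|] := eqVneq v x.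
  rewrite (segmentC (place R pos u)) => z /(fork _ _ _ o) ->.
  by exists v => //; split; [right|left].
have [<- _ _ _ o _ _|] := eqVneq v y.
  rewrite (segmentC (place R pos u)) (segmentC (place R pos x)) => z /(fork _ _ _ o) ->.
  by exists v => //; split; right.
move=> _ _ _ _ /orP[] o _ _; first by rewrite sep.
by rewrite setIC sep.
Qed.

(** On the line of [d] the orientations of the vertices of [t], weighted by
    the barycentric coordinates of a point, sum to zero; inside [t] the weights
    are positive. *)
Lemma avoidsP (R : realType) (pos : nat -> Z * Z) (t : nat * nat * nat)
    (d : nat * nat) :
  avoids pos t d ->
  interior_triangle (place R pos t.1.1) (place R pos t.1.2) (place R pos t.2) `&`
  segment (place R pos d.1) (place R pos d.2) = set0.
Proof.
case: t d => [[a b] c] [u v] /= h; apply/seteqP; split=> // z.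
case=> /and3P[z1 z2 z3] [s + ez]; rewrite /= in_itv /= => /andP[s0 s1].
have neg i j : orientation pos i j u <= 0 -> orientation pos i j v <= 0 ->
    0 < det (place R pos i) (place R pos j) z -> False.
  rewrite -!(embed_le0 R) -!det_place -ez det_lin => hu hv.
  by apply/negP; rewrite -leNgt; nra.
have side : det (place R pos u) (place R pos v) z = 0.
  by rewrite -ez det_lin !det_self; ring.
(* z is a convex combination of the vertices of t with positive coefficients *)
have bary : det (place R pos b) (place R pos c) z * embed R (orientation pos u v a) +
    det (place R pos c) (place R pos a) z * embed R (orientation pos u v b) +
    det (place R pos a) (place R pos b) z * embed R (orientation pos u v c) = 0.
  rewrite -!det_place -[RHS](mulr0 (det (place R pos a) (place R pos b) (place R pos c))).
  by rewrite -side /det; ring.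
move: h => /orP[/or4P[/andP[]|/andP[]|/andP[]|//]|].
- by move=> hu hv; exact: neg hu hv z1.
- by move=> hu hv; exact: neg hu hv z2.
- by move=> hu hv; exact: neg hu hv z3.
rewrite /= !orbF !andbT -!(embed_eq0 R) -!(embed_le0 R) -!(embed_ge0 R).
move: bary z1 z2 z3 {neg side ez}.
move: (embed R _) (embed R _) (embed R _) => xa xb xc.
move: (det _ _ z) (det _ _ z) (det _ _ z) => la lb lc.
have nz (x y : R) : 0 < x -> x * y = 0 -> y = 0.
  by move=> x0 /eqP; rewrite mulf_eq0 gt_eqF //= => /eqP.
move=> bary lc0 la0 lb0 /andP[nonzero]; case/orP => /and3P[ha hb hc].
- have pa : la * xa <= 0 by nra.
  have pb : lb * xb <= 0 by nra.
  have pc : lc * xc <= 0 by nra.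
  have ea : xa = 0 by apply: (nz la) => //; lra.
  have eb : xb = 0 by apply: (nz lb) => //; lra.
  have ec : xc = 0 by apply: (nz lc) => //; lra.
  by move: nonzero; rewrite ea eb ec eqxx.
- have pa : 0 <= la * xa by nra.
  have pb : 0 <= lb * xb by nra.
  have pc : 0 <= lc * xc by nra.
  have ea : xa = 0 by apply: (nz la) => //; lra.
  have eb : xb = 0 by apply: (nz lb) => //; lra.
  have ec : xc = 0 by apply: (nz lc) => //; lra.
  by move: nonzero; rewrite ea eb ec eqxx.
Qed.

Lemma flipK : involutive flip. Proof. by case. Qed.

Lemma crossing_flip (R : realDomainType) (a b z : R * R) :
  crossing b a z = - crossing a b z.
Proof. by rewrite /crossing opprB. Qed.

(** The sum equals its opposite, since reversal permutes [D]. *)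
Lemma sum_crossing_closed (w : nat * nat -> int) (D : seq (nat * nat)) :
  (forall d, w (flip d) = - w d) -> uniq D -> all (fun d => flip d \in D) D ->
  \sum_(d <- D) w d = 0.
Proof.
move=> wN uD /allP cD.
have pD : perm_eq D [seq flip d | d <- D].
  apply: uniq_perm => //; first by rewrite (map_inj_uniq (inv_inj flipK)).
  move=> d; apply/idP/mapP => [dD|[d' d'D ->]]; last exact: cD.
  by exists (flip d); [exact: cD|rewrite flipK].
have : \sum_(d <- D) w d = - \sum_(d <- D) w d.
  rewrite {1}(perm_big _ pD) big_map -sumrN.
  by apply: eq_bigr => d _.
by move/eqP; rewrite -subr_eq0 opprK -mulr2n mulrn_eq0 => /eqP.
Qed.

(** Summing [crossing_triangle] over [faces], the inner edges cancel, and the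
    number of triangles of [faces] around [z] equals that for [outer]. *)
Lemma face_cover (R : realType) (pos : nat -> Z * Z) faces outer (z : plane R) :
  (forall t, t \in outer :: faces -> 0 < orientation pos t.1.1 t.1.2 t.2) ->
  uniq (face_darts faces outer) ->
  all (fun d => flip d \in face_darts faces outer) (face_darts faces outer) ->
  (forall t, t \in outer :: faces ->
    forall s, s \in sides t -> ~ segment (place R pos s.1) (place R pos s.2) z) ->
  exterior_triangle (place R pos outer.1.1) (place R pos outer.1.2)
    (place R pos outer.2) z
  \/ exists2 t, t \in faces &
    interior_triangle (place R pos t.1.1) (place R pos t.1.2) (place R pos t.2) z.
Proof.
move=> ccw uD cD off.
pose P := place R pos.
pose w (d : nat * nat) := crossing (P d.1) (P d.2) z.
have D0 t : t \in outer :: faces -> 0 < det (P t.1.1) (P t.1.2) (P t.2).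
  by move=> tF; rewrite det_place embed_gt0; exact: ccw.
have in_or_out t : t \in outer :: faces ->
    covers (P t.1.1) (P t.1.2) (P t.2) z -> inside (P t.1.1) (P t.1.2) (P t.2) z.
  move=> tF cz; apply/negPn/negP => nz.
  have := triangle_boundary (D0 _ tF) => /(congr1 (fun A => A z)) /= e.
  have : (segment (P t.1.1) (P t.1.2) `|` segment (P t.1.2) (P t.2) `|`
          segment (P t.2) (P t.1.1)) z by rewrite /setU /= -e.
  have offt := off _ tF.
  by case=> [[|]|]; [apply: (offt t.1)|apply: (offt (t.1.2, t.2))|
    apply: (offt (t.2, t.1.1))]; rewrite /sides !inE eqxx ?orbT.
have wt t : t \in outer :: faces ->
    \sum_(s <- sides t) w s = (inside (P t.1.1) (P t.1.2) (P t.2) z)%:Z.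
  move=> tF; rewrite /sides !big_cons big_nil addr0 addrA.
  by apply: crossing_triangle; [exact: D0|exact: in_or_out].
have := sum_crossing_closed (w := w) (fun d => crossing_flip _ _ _) uD cD.
rewrite /face_darts big_cat big_flatten !big_map /=.
under [X in _ + X]eq_bigr do rewrite /w /= crossing_flip.
rewrite sumrN [X in _ - X]wt ?mem_head // => /eqP; rewrite subr_eq0 => /eqP sum.
have [iz|] := boolP (inside (P outer.1.1) (P outer.1.2) (P outer.2) z); last first.
  by move=> nz; left; apply: contra nz => /in_or_out; apply; rewrite mem_head.
right; rewrite iz in sum.
have [/hasP[t tF tz]|/hasPn none] :=
  boolP (has (fun t => inside (P t.1.1) (P t.1.2) (P t.2) z) faces).
  by exists t.
move: sum; rewrite big_seq big1 // => t tF.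
by rewrite wt ?inE ?tF ?orbT // (negPf (none _ tF)).
Qed.

(** A vertex inside an edge would be a crossing of this edge with one of the
    edges at the vertex, so only pairs of edges have to be compared.  By
    [face_cover] every point off the drawing lies in one of the expected
    regions, each of which is a whole face by [connected_component_open]. *)
Lemma drawing_checkP (R : realType) (n : nat) (g : rel 'I_n)
    (pos : nat -> Z * Z) (E : seq (nat * nat))
    (faces : seq (nat * nat * nat)) (outer : nat * nat * nat) :
  (forall u v : 'I_n, g u v = ((val u, val v) \in E)) ->
  drawing_check n pos E faces outer -> planar_triangulation R g.
Proof.
move=> gE /and5P[uP /allP vE /allP wfE /allP triE].
move=> /and3P[/andP[uD cD] /allrelP EE /allP EF].
have wf d : d \in E -> [/\ (d.1 < n)%N, (d.2 < n)%N, d.1 != d.2 & flip d \in E].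
  by move=> /wfE/and4P.
have gsym : symmetric g.
  move=> u v; rewrite !gE.
  by apply/idP/idP => /wf[_ _ _].
have girr : irreflexive g.
  by move=> u; rewrite gE; apply/negP => /wf[_ _ /=]; rewrite eqxx.
pose p (i : 'I_n) := place R pos i.
pose C (u v : 'I_n) := segment (p u) (p v).
have pinj : injective p.
  move=> u v /embed_point_inj e; apply: val_inj => /=.
  have nthE (i : 'I_n) : nth (pos 0%N) [seq pos k | k <- iota 0 n] i = pos i.
    by rewrite (nth_map 0%N) ?size_iota // nth_iota.
  apply/eqP; rewrite -(nth_uniq (pos 0%N) _ _ uP) ?size_map ?size_iota //.
  by rewrite !nthE e.
have vert (w : 'I_n) : exists x, g w x.
  have : val w \in iota 0 n by rewrite mem_iota /= add0n.
  case/vE/hasP=> -[a b] dE /eqP /= aw; have [_ /= bn _ _] := wf _ dE.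
  by exists (Ordinal bn); rewrite gE /= -aw.
have cross (u v x y : 'I_n) : g u v -> g x y -> [set u; v] <> [set x; y] ->
    C u v `&` C x y `<=` p @` ([set u; v] `&` [set x; y]).
  rewrite !gE => uv xy ne.
  have n1 : (val u, val v) <> (val x, val y).
    by case=> /val_inj ex /val_inj ey; apply: ne; rewrite ex ey.
  have n2 : (val u, val v) <> (val y, val x).
    by case=> /val_inj ex /val_inj ey; apply: ne; rewrite ex ey setUC.
  have := disjoint_or_forkP (EE _ _ uv xy) n1 n2.
  move=> sub z /(sub R) [k [k1 k2] <-].
  have back (a b : 'I_n) : [set val a; val b] k -> exists2 c, [set a; b] c & val c = k.
    by case=> ->; [exists a => //; left|exists b => //; right].
  have [c1 c1P ek] := back _ _ k1; have [c2 c2P ek2] := back _ _ k2.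
  exists c1; last by rewrite /p ek.
  split=> //; suff -> : c1 = c2 by [].
  by apply: val_inj; rewrite ek ek2.
split=> //; exists p, C; split.
  split=> //.
  - move=> u v guv; split; last exact: segmentC.
    apply: segment_arc; apply: contraTneq guv => /pinj ->.
    by rewrite girr.
  - move=> u v w guv uvw; have [x gwx] := vert w.
    have [e|ne] := pselect ([set u; v] = [set w; x]).
      by have : [set u; v] w by rewrite e; left.
    have wx : C w x (p w) by exact: segment_end.
    by have [c [uvc _] /pinj e] := cross _ _ _ _ guv gwx ne _ (conj uvw wx);
      case: uvc => <-; [left|right].
set S := drawing_support g p C.
have SE z : S z -> exists2 d, d \in E & segment (place R pos d.1) (place R pos d.2) z.
  case=> [[w _ <-]|[u [v [guv uvz]]]].
    have [x gwx] := vert w; exists (val w, val x); first by rewrite -gE.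
    exact: segment_end.
  by exists (val u, val v) => //; rewrite -gE.
have ES d z : d \in E -> segment (place R pos d.1) (place R pos d.2) z -> S z.
  case: d => a b dE abz; have [/= an bn _ _] := wf _ dE.
  by right; exists (Ordinal an), (Ordinal bn); rewrite gE.
pose P := place R pos.
have sideE t s : t \in outer :: faces -> s \in sides t -> s \in E.
  by move=> /triE/andP[_ /allP sE] /sE.
have triS t : t \in outer :: faces ->
    segment (P t.1.1) (P t.1.2) `|` segment (P t.1.2) (P t.2) `|`
    segment (P t.2) (P t.1.1) `<=` S.
  move=> tF z; have sE := sideE _ _ tF.
  by case=> [[|]|]; [apply: (ES t.1)|apply: (ES (t.1.2, t.2))|
    apply: (ES (t.2, t.1.1))]; apply: sE; rewrite /sides !inE eqxx ?orbT.
have D0 t : t \in outer :: faces -> 0 < det (P t.1.1) (P t.1.2) (P t.2).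
  by move=> /triE/andP[pos_t _]; rewrite det_place embed_gt0.
have triangular t F : t \in outer :: faces ->
    frontier F = segment (P t.1.1) (P t.1.2) `|` segment (P t.1.2) (P t.2) `|`
      segment (P t.2) (P t.1.1) -> triangular_face g C F.
  move=> tF; have sE := sideE _ _ tF.
  case: t tF sE => [[a b] c] /= tF sE fr.
  have ab := sE (a, b) (mem_head _ _).
  have bc : (b, c) \in E by apply: sE; rewrite !inE eqxx orbT.
  have ca : (c, a) \in E by apply: sE; rewrite !inE eqxx !orbT.
  have [/= an bn _ _] := wf _ ab; have [/= _ cn _ _] := wf _ bc.
  by exists (Ordinal an), (Ordinal bn), (Ordinal cn); split; rewrite ?gE.
move=> F [z zS ->].
have off t : t \in outer :: faces -> forall s, s \in sides t ->
    ~ segment (place R pos s.1) (place R pos s.2) z.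
  by move=> tF s st sz; apply: zS; apply: ES sz; exact: sideE st.
have ccw t : t \in outer :: faces -> 0 < orientation pos t.1.1 t.1.2 t.2.
  by move=> /triE/andP[].
have [ext|[t tF int]] := face_cover ccw uD cD off.
  have oF : outer \in outer :: faces by rewrite mem_head.
  have bd := triangle_boundary (D0 _ oF).
  have op := @exterior_triangle_open R (P outer.1.1) (P outer.1.2) (P outer.2).
  have fr : frontier (exterior_triangle (P outer.1.1) (P outer.1.2) (P outer.2)) =
      [set z | covers (P outer.1.1) (P outer.1.2) (P outer.2) z /\
        ~~ inside (P outer.1.1) (P outer.1.2) (P outer.2) z].
    rewrite open_frontier // closure_exterior_triangle ?D0 //.
    rewrite /exterior_triangle; apply/seteqP; split=> x /=.
      by case=> ni /negP/negPn.
    by case=> cx ni; split=> //; rewrite cx.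
  rewrite (connected_component_open op) //.
  - by apply: (triangular outer) => //; rewrite fr bd.
  - exact: exterior_triangle_connected (D0 _ oF).
  - apply/seteqP; split=> // x [xext /SE[d dE [s + ex]]].
    rewrite /= in_itv /= => /andP[s0 s1]; move: xext.
    have /andP[/allP cd _] := EF _ dE.
    have [_ _ _ fE] := wf _ dE; have /andP[/allP cd' _] := EF _ fE.
    apply/negP/negPn; rewrite -ex /covers !det_lin.
    have ge0 k : k \in sides outer ->
        0 <= (1 - s) * det (P k.1) (P k.2) (place R pos d.1) +
             s * det (P k.1) (P k.2) (place R pos d.2).
      move=> kO; have := cd _ kO; have := cd' _ kO.
      rewrite -!(embed_ge0 R) -!det_place => h1 h2.
      by apply: addr_ge0; apply: mulr_ge0 => //; rewrite subr_ge0.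
    have := ge0 outer.1; have := ge0 (outer.1.2, outer.2).
    have := ge0 (outer.2, outer.1.1); rewrite /sides !inE !eqxx !orbT /=.
    by move=> /(_ isT) -> /(_ isT) -> /(_ isT) ->.
  - by rewrite -open_frontier // fr bd; exact: triS.
have tF' : t \in outer :: faces by rewrite inE tF orbT.
have bd := triangle_boundary (D0 _ tF').
have op := @interior_triangle_open R (P t.1.1) (P t.1.2) (P t.2).
have fr : frontier (interior_triangle (P t.1.1) (P t.1.2) (P t.2)) =
    [set z | covers (P t.1.1) (P t.1.2) (P t.2) z /\
      ~~ inside (P t.1.1) (P t.1.2) (P t.2) z].
  rewrite open_frontier // closure_interior_triangle ?D0 //.
  rewrite /interior_triangle; apply/seteqP; split=> x /=.
    by case=> cx /negP.
  by case=> cx /negP.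
rewrite (connected_component_open op) //.
- by apply: (triangular t) => //; rewrite fr bd.
- exact: interior_triangle_connected.
- apply/seteqP; split=> // x [xint /SE[d dE xd]].
  have /andP[_ /allP/(_ _ tF) av] := EF _ dE.
  by rewrite -(avoidsP R av); split.
- by rewrite -open_frontier // fr bd; exact: triS.
Qed.

Local Close Scope classical_set_scope.
Local Close Scope ring_scope.

(** * An obstruction to CAI-partitions *)

Lemma acyclic_no_4cycle (T : finType) (e : rel T) (A : {set T}) (w x y z : T) :
  acyclic (induced_digraph e A) -> w \in A -> x \in A -> y \in A -> z \in A ->
  uniq [:: w; x; y; z] -> e w x -> e x y -> e y z -> ~ e z w.
Proof.
move=> acy wA xA yA zA uni wx xy yz zw.
have /negP := acy [:: exist _ w wA; exist _ x xA; exist _ y yA; exist _ z zA].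
apply; apply/andP; split=> //; apply/andP; split; first by apply/and5P.
by rewrite -(map_inj_uniq val_inj).
Qed.

Lemma connected_neighbour (T : finType) (e : rel T) (A : {set T}) (x y : T) :
  connected_digraph (induced_digraph e A) -> x \in A -> y \in A -> x != y ->
  exists2 v, v \in A & underlying e x v.
Proof.
move=> con xA yA xy; have := con (exist _ x xA) (exist _ y yA).
case/connectP=> -[/= _ [/esym e1]|[v vA] p /= /andP[xv _] _].
  by rewrite e1 eqxx in xy.
by exists v.
Qed.

Lemma Z4_arith (i : 'Z_4) :
  [/\ (i + 3%:R + 1)%R = i, (i + 1 + 2%:R)%R = (i + 3%:R)%R,
      (i + 3%:R + 2%:R)%R = (i + 1)%R, (i + 1 + 1)%R = (i + 2%:R)%R &
      (i + 2%:R + 1)%R = (i + 3%:R)%R].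
Proof. by split; apply: val_inj; case: i => [[|[|[|[|]]]]]. Qed.

Lemma Z4_distinct (i : 'Z_4) : uniq [:: i + 1; i + 2%:R; i + 3%:R]%R.
Proof. by case: i => [[|[|[|[|]]]]]. Qed.

(** The argument given at the top, started at a vertex [c i] in [J] instead of c_0;
    [pendant] is its recurring step, that no [s j] is isolated in [A]. *)
Lemma no_CAI_partition (T : finType) (e : rel T) (c d s : 'Z_4 -> T) :
  (forall i, [/\ e (c i) (c (i + 1)%R), e (c i) (d i) & e (d i) (c (i + 2%:R)%R)]) ->
  (forall i, underlying e (s i) (c (i + 1)%R)) ->
  (forall i v, underlying e (s i) v -> v = d i \/ v = c (i + 1)%R) ->
  injective c -> injective d -> (forall i j, c i != d j) ->
  (forall i j, s i != c j) ->
  ~ exists A J : {set T}, CAI_partition e A J.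
Proof.
move=> arcs sc snbr cinj dinj cd_ne sc_ne [A [J [AJ dis con acy indep]]].
have AorJ x : x \in A \/ x \in J.
  by apply/orP; rewrite -finset.in_setU AJ finset.in_setT.
have nbrA x y : x \in J -> underlying e x y -> y \in A.
  move=> xJ xy; case: (AorJ y) => // yJ.
  by have := indep _ _ xJ yJ; rewrite xy.
have usym x y : underlying e x y = underlying e y x by rewrite /underlying /= orbC.
have arcU x y : e x y -> underlying e x y by rewrite /underlying /= => ->.
have cc i : e (c i) (c (i + 1)%R) by case: (arcs i).
have cd i : e (c i) (d i) by case: (arcs i).
have dc i : e (d i) (c (i + 2%:R)%R) by case: (arcs i).
have cne i j : i != j -> (c i == c j) = false.
  by move=> ij; rewrite (inj_eq cinj) (negPf ij).
have [i ciJ] : exists i, c i \in J.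
  have [c1|] := AorJ (c 1%R); last by exists 1%R.
  have [c2|] := AorJ (c 2%:R%R); last by exists 2%:R%R.
  have [c3|] := AorJ (c 3%:R%R); last by exists 3%:R%R.
  have [c0|] := AorJ (c 0%R); last by exists 0%R.
  have [e31 _ _ e11 e21] := Z4_arith 0%R.
  rewrite !add0r in e31 e11 e21.
  exfalso; apply: (acyclic_no_4cycle acy c0 c1 c2 c3).
  - exact: etrans (map_inj_uniq cinj [:: 0; 1; 2%:R; 3%:R]%R) _.
  - by have := cc 0%R; rewrite add0r.
  - by have := cc 1%R; rewrite e11.
  - by have := cc 2%:R%R; rewrite e21.
  - by have := cc 3%:R%R; rewrite e31.
(* from here on, i plays the part of the index 0 *)
have [i31 i12 i32 i11 i21] := Z4_arith i.
have c1A : c (i + 1)%R \in A by apply: (nbrA _ _ ciJ); exact: arcU.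
have c3A : c (i + 3%:R)%R \in A.
  by apply: (nbrA _ _ ciJ); rewrite usym arcU // -{2}i31.
have pendant j : c (j + 1)%R \in J -> d j \in A.
  move=> cJ; have sA : s j \in A by apply: (nbrA _ _ cJ); rewrite usym.
  have [v vA /snbr[<- //|ve]] := connected_neighbour con sA c1A (sc_ne _ _).
  by move/disjoint_setI0: dis => /setP/(_ v); rewrite !inE vA ve cJ.
have d3A : d (i + 3%:R)%R \in A by apply: pendant; rewrite i31.
have e1 := cc (i + 1)%R; rewrite i11 in e1.
have e2 := cc (i + 2%:R)%R; rewrite i21 in e2.
have e3 := dc (i + 1)%R; rewrite i12 in e3.
have e4 := dc (i + 3%:R)%R; rewrite i32 in e4.
have := Z4_distinct i; rewrite /= !inE negb_or => /and3P[/andP[n12 n13] n23 _].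
have d1A : d (i + 1)%R \notin A.
  apply/negP => d1A; apply: (acyclic_no_4cycle acy c1A d1A c3A d3A) => //.
  by rewrite /= !inE !negb_or !cd_ne (inj_eq cinj) (inj_eq dinj) n13 eq_sym cd_ne.
have c2A : c (i + 2%:R)%R \in A.
  case: (AorJ (c (i + 2%:R)%R)) => // c2J.
  by move: d1A; rewrite pendant // i11.
apply: (acyclic_no_4cycle acy c1A c2A c3A d3A) => //.
by rewrite /= !inE !negb_or !cd_ne !(inj_eq cinj) n12 n13 n23.
Qed.

(** * Digraphs given by lists of arcs *)

Definition list_digraph (n : nat) (arcs : seq (nat * nat)) : rel 'I_n :=
  [rel u v | (val u, val v) \in arcs].
Arguments list_digraph n arcs : clear implicits.

Definition adj (arcs : seq (nat * nat)) (u v : nat) : bool :=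
  ((u, v) \in arcs) || ((v, u) \in arcs).

Lemma underlying_list n arcs (u v : 'I_n) :
  underlying (list_digraph n arcs) u v = adj arcs u v.
Proof. by []. Qed.

Lemma oriented_list n arcs :
  all (fun a => flip a \notin arcs) arcs -> oriented (list_digraph n arcs).
Proof.
move=> /allP asym c /andP[_ /andP[cyc _]]; split; apply/eqP => sz.
  case: c sz cyc => [|x []] //= _; rewrite andbT => xx.
  by have /negP := asym _ xx; apply.
case: c sz cyc => [|x [|y []]] //= _ /and3P[xy yx _].
by have /negP := asym _ xy; apply.
Qed.

Lemma card_ord_pred n (P : pred nat) : #|[pred u : 'I_n | P u]| = count P (iota 0 n).
Proof. by rewrite -sum1_card -(big_mkord P (fun=> 1)) sum1_count /index_iota subn0. Qed.

(** Connectedness: every vertex but 0 has a neighbour with a smaller number, so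
    that descent leads to 0. *)
Lemma eulerian_list n arcs :
  all (fun v => has (adj arcs v) (iota 0 v)) (iota 1 n.-1) ->
  all (fun v => count (fun u => (u, v) \in arcs) (iota 0 n) ==
                count (fun u => (v, u) \in arcs) (iota 0 n)) (iota 0 n) ->
  eulerian (list_digraph n arcs).
Proof.
move=> /allP low /allP bal; split; last first.
  move=> v; rewrite /indegree /outdegree.
  rewrite (card_ord_pred _ (fun u => (u, val v) \in arcs)).
  rewrite (card_ord_pred _ (fun u => (val v, u) \in arcs)).
  by apply/eqP/bal; rewrite mem_iota /=.
move=> u v.
have usym : connect_sym (underlying (list_digraph n arcs)).
  by apply: sym_connect_sym => x y; rewrite /underlying /= orbC.
have n0 : 0 < n by case: u => m; apply: leq_ltn_trans.
suff root w : connect (underlying (list_digraph n arcs)) w (Ordinal n0).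
  by rewrite (connect_trans (root u)) // usym.
have [k] := ubnP (val w); elim: k w => // k IH w; rewrite ltnS => wk.
have [w0|w0] := posnP (val w).
  by rewrite (_ : w = Ordinal n0) ?connect0 //; exact: val_inj.
have /low/hasP[x] : val w \in iota 1 n.-1.
  by rewrite mem_iota w0 add1n prednK /=.
rewrite mem_iota /= add0n => xw wx.
have xn : x < n by exact: ltn_trans xw (ltn_ord w).
apply: connect_trans (IH (Ordinal xn) (leq_trans xw wk)).
by apply: connect1; rewrite underlying_list.
Qed.

Definition colour_class n (col : nat -> nat) (k : nat) : {set 'I_n} :=
  [set v : 'I_n | col v == k].
Arguments colour_class n col k : clear implicits.

Definition colour_classes n (col : nat -> nat) : {set {set 'I_n}} :=
  [set colour_class n col (val k) | k : 'I_3].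
Arguments colour_classes n col : clear implicits.

Definition neighbour_table (n : nat) (arcs : seq (nat * nat)) : seq (seq nat) :=
  [seq [seq u <- iota 0 n | adj arcs v u] | v <- iota 0 n].

(** Two vertices that are both adjacent to the ends of an edge have the same
    colour in all proper colourings with three colours; each round applies
    this once.  The rows of the table are restricted to known vertices at the
    beginning of the round to keep the evaluation short. *)
Definition grow (n : nat) (table : seq (seq nat)) (col : nat -> nat)
    (known : seq nat) : seq nat :=
  let rows := [seq [seq x <- row | x \in known] | row <- table] in
  let nb := nth [::] rows in
  known ++ [seq v <- [seq v <- iota 0 n | v \notin known] |
    has (fun x => has (fun y => has (fun w => (col w == col v) && (y \in nb w))
      (nb x)) [seq y <- nb v | y \in nb x]) (nb v)].

(** [b k] is the vertex of colour [k] of a triangle from which the colouring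
    can be reconstructed by [grow]. *)
Definition tripartition_check (n : nat) (arcs : seq (nat * nat))
    (col b : nat -> nat) : bool :=
  [&& all (fun k => (b k < n) && (col (b k) == k)) (iota 0 3),
      all (fun k => all (fun l => (k == l) || adj arcs (b k) (b l)) (iota 0 3))
        (iota 0 3),
      all (fun v => col v < 3) (iota 0 n),
      all (fun a => col a.1 != col a.2) arcs &
      let known := iter n (grow n (neighbour_table n arcs) col)
                     [seq b k | k <- iota 0 3] in
      all [in known] (iota 0 n)].

Lemma adj_sym arcs u v : adj arcs u v = adj arcs v u.
Proof. by rewrite /adj orbC. Qed.

(** In a tripartition adjacent vertices are in different blocks.  As there are
    only three blocks, the two vertices opposite to an edge [xy] both belong to
    the block that contains neither [x] nor [y] ([third]).  So along [grow] the
    block of a vertex is that of the base vertex of its colour. *)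
Lemma tripartition_list n arcs col b :
  tripartition_check n.+1 arcs col b ->
  unique (tripartition (list_digraph n.+1 arcs)) (colour_classes n.+1 col).
Proof.
move=> /and5P[/allP base /allP tri /allP col3 /allP proper /allP reach].
have {}base k : k < 3 -> b k < n.+1 /\ col (b k) = k.
  by move=> k3; have /andP[? /eqP] : (b k < n.+1) && (col (b k) == k)
    by apply: base; rewrite mem_iota.
have {}tri k l : k < 3 -> l < 3 -> k != l -> adj arcs (b k) (b l).
  move=> k3 l3 kl.
  have /allP/(_ l) : all (fun l => (k == l) || adj arcs (b k) (b l)) (iota 0 3).
    by apply: tri; rewrite mem_iota.
  by rewrite mem_iota l3 (negPf kl); apply.
have {}col3 (v : 'I_n.+1) : col v < 3 by apply: col3; rewrite mem_iota /=.
have {}proper u v : adj arcs u v -> col u != col v.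
  by case/orP => /proper //=; rewrite eq_sym.
pose bo k : 'I_n.+1 := inord (b k).
have boE k : k < 3 -> bo k = b k :> nat by move=> /base[? _]; rewrite inordK.
have bo_class k : k < 3 -> bo k \in colour_class n.+1 col k.
  by move=> k3; rewrite inE boE //; apply/eqP; case: (base k k3).
have class_inj : injective (fun k : 'I_3 => colour_class n.+1 col (val k)).
  move=> k l /= e; have := bo_class _ (ltn_ord k); rewrite e inE.
  rewrite boE ?ltn_ord //; have [_ ->] := base _ (ltn_ord k).
  by move/eqP => kl; apply: val_inj.
have card3 : #|colour_classes n.+1 col| = 3 by rewrite card_imset // card_ord.
split.
  split=> //; last first.
    move=> I /imsetP[k _ ->] u v; rewrite !inE => /eqP uk /eqP vk.
    by rewrite underlying_list; apply/negP => /proper; rewrite uk vk eqxx.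
  apply/and3P; split.
  - apply/eqP/setP => v; rewrite inE; apply/bigcupP.
    exists (colour_class n.+1 col (col v)); last by rewrite inE.
    by apply/imsetP; exists (Ordinal (col3 v)).
  - apply/finset.trivIsetP => _ _ /imsetP[k _ ->] /imsetP[l _ ->] kl.
    rewrite -setI_eq0; apply/eqP/setP => v; rewrite !inE.
    apply/negP => /andP[/eqP vk /eqP vl]; case/negP: kl.
    by rewrite -vk -vl.
  - apply/negP => /imsetP[k _ /setP/(_ (bo k))].
    by rewrite bo_class ?ltn_ord // inE.
move=> Q [partQ cardQ indepQ]; have /and3P[/eqP covQ trivQ _] := partQ.
pose blk (v : nat) := finset.pblock Q (inord v : 'I_n.+1).
have mem_blk v : (inord v : 'I_n.+1) \in blk v by rewrite finset.mem_pblock covQ inE.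
have blkQ v : blk v \in Q by rewrite finset.pblock_mem // covQ inE.
have adj_blk u v : u < n.+1 -> v < n.+1 -> adj arcs u v -> blk u != blk v.
  move=> un vn uv; apply/eqP => e; have := indepQ _ (blkQ v) (inord u) (inord v).
  by rewrite -{1}e !mem_blk underlying_list !inordK // uv => /(_ isT isT).
have third x y w B : blk x != blk y -> blk w != blk x -> blk w != blk y ->
    B \in Q -> B != blk x -> B != blk y -> B = blk w.
  move=> xy wx wy BQ Bx By; have : [set blk x; blk y; blk w] = Q.
    apply/eqP; rewrite eqEcard cardQ; apply/andP; split.
      by apply/fintype.subsetP => X; rewrite !inE -orbA => /or3P[] /eqP->.
    by rewrite finset.setUC cardsU1 !inE cards2 negb_or wx wy xy.
  by move=> e; move: BQ; rewrite -e !inE (negPf Bx) (negPf By) => /eqP.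
have known v : v < n.+1 -> blk v = blk (b (col v)).
  move=> vn.
  pose round m := iter m (grow n.+1 (neighbour_table n.+1 arcs) col)
                    [seq b k | k <- iota 0 3].
  have : v \in round n.+1 by apply: reach; rewrite mem_iota.
  move: {1}n.+1 => m.
  suff inv u : u \in round m -> u < n.+1 /\ blk u = blk (b (col u)) by case/inv.
  rewrite /round {round}.
  elim: m u => [|m IH] {vn}v.
    case/mapP=> k; rewrite mem_iota => /base[bn ck] ->.
    by rewrite ck.
  rewrite iterS /grow mem_cat => /orP[/IH //|].
  set known := iter m _ _ in IH *; set rows := [seq _ | row <- _].
  have nbP x y : x < n.+1 -> y \in nth [::] rows x -> adj arcs x y /\ y \in known.
    move=> xn; rewrite (nth_map [::]) ?size_map ?size_iota // mem_filter.
    move=> /andP[yk]; rewrite (nth_map 0) ?size_iota // nth_iota //.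
    by rewrite mem_filter => /andP[].
  rewrite mem_filter mem_filter mem_iota add0n => /andP[hx /andP[_ /andP[_ vn]]].
  split=> //; case/hasP: hx => x /(nbP _ _ vn)[vx /IH[xn _]].
  case/hasP => y; rewrite mem_filter => /andP[/(nbP _ _ xn)[xy /IH[yn _]]].
  move=> /(nbP _ _ vn)[vy _] /hasP[w /(nbP _ _ xn)[xw /IH[wn bw]]].
  case/andP => /eqP wv /(nbP _ _ wn)[wy _].
  by rewrite -wv -bw; apply: (third x y); rewrite ?adj_blk // adj_sym.
have classE (k : 'I_3) : colour_class n.+1 col k = blk (b k).
  have [bn ck] := base _ (ltn_ord k).
  apply/setP => v; rewrite inE; apply/eqP/idP => [vk|vB].
    by rewrite -vk -known ?ltn_ord // -{1}(inord_val v) mem_blk.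
  apply/eqP; apply: contraTT vB => vk.
  have : blk v != blk (b k).
    rewrite known // adj_blk ?tri //; by case: (base _ (col3 v)).
  apply: contra => vB; apply/eqP; rewrite /blk inord_val.
  exact: finset.same_pblock.
apply/eqP; rewrite eqEcard card3 cardQ leqnn andbT.
by apply/fintype.subsetP => _ /imsetP[k _ ->]; rewrite classE.
Qed.

(** [m] embeds the core, with [m i], [m (4 + i)] and [m (8 + i)] as c_i, d_i
    and s_i, off the class of colour [k]; the vertex s_i may have further
    neighbours in that class only. *)
Definition gadget_check (n : nat) (arcs : seq (nat * nat)) (col : nat -> nat)
    (k : nat) (m : nat -> nat) : bool :=
  let c i := m (i %% 4) in let d i := m (4 + i) in let s i := m (8 + i) in
  [&& uniq [seq m j | j <- iota 0 12],
      all (fun j => (m j < n) && (col (m j) != k)) (iota 0 12) &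
      all (fun i =>
        [&& (c i, c i.+1) \in arcs, (c i, d i) \in arcs, (d i, c i.+2) \in arcs,
            adj arcs (s i) (c i.+1) &
            all (fun v => adj arcs (s i) v ==>
              [|| col v == k, v == d i | v == c i.+1]) (iota 0 n)]) (iota 0 4)].

Lemma gadget_no_CAI n arcs col k m :
  gadget_check n.+1 arcs col k m ->
  ~ exists A J : {set {x : 'I_n.+1 | x \in ~: colour_class n.+1 col k}},
      CAI_partition
        (induced_digraph (list_digraph n.+1 arcs) (~: colour_class n.+1 col k)) A J.
Proof.
move=> /and3P[mU /allP mn /allP mE].
have {}mn j : j < 12 -> m j < n.+1 /\ col (m j) != k.
  by move=> j12; apply/andP/mn; rewrite mem_iota.
have inC j : j < 12 -> (inord (m j) : 'I_n.+1) \in ~: colour_class n.+1 col k.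
  by move=> /mn[mjn ck]; rewrite !inE inordK.
pose x0 : {x : 'I_n.+1 | x \in ~: colour_class n.+1 col k} :=
  exist (fun x => x \in _) _ (inC 0 isT).
pose h j := insubd x0 (inord (m j) : 'I_n.+1).
have hE j : j < 12 -> val (val (h j)) = m j.
  by move=> j12; rewrite val_insubd inC //= inordK //; case: (mn _ j12).
have hI i j : i < 12 -> j < 12 -> (h i == h j) = (i == j).
  move=> i12 j12; apply/eqP/eqP => [e|-> //].
  have : m i == m j by rewrite -!hE // e.
  have nthE l : l < 12 -> nth 0 [seq m x | x <- iota 0 12] l = m l.
    by move=> l12; rewrite (nth_map 0) ?size_iota // nth_iota.
  by rewrite -!nthE // nth_uniq ?size_map ?size_iota // => /eqP.
have i4 (i : 'Z_4) : i < 4 by exact: ltn_ord.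
have d12 (i : 'Z_4) : 4 + i < 12 by rewrite (leq_trans (n := 4 + 4)) // ltn_add2l.
have s12 (i : 'Z_4) : 8 + i < 12 by rewrite (ltn_add2l 8 i 4).
have c12 (i : 'Z_4) : i < 12 by rewrite (ltn_trans (i4 i)).
have add1 (i : 'Z_4) : (i + 1)%R = i.+1 %% 4 :> nat.
  by case: i => [[|[|[|[|]]]]].
have add2 (i : 'Z_4) : (i + 2%:R)%R = i.+2 %% 4 :> nat.
  by case: i => [[|[|[|[|]]]]].
have {}mE (i : 'Z_4) :
   let c i := m (i %% 4) in let d i := m (4 + i) in let s i := m (8 + i) in
   [/\ (c i, c i.+1) \in arcs, (c i, d i) \in arcs, (d i, c i.+2) \in arcs,
            adj arcs (s i) (c i.+1) &
            forall v, v < n.+1 -> adj arcs (s i) v ->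
              [|| col v == k, v == d i | v == c i.+1]].
  have /and5P[? ? ? ? /allP nb] := mE i (ltac:(by rewrite mem_iota i4)).
  by split=> // v vn sv; apply: (implyP (nb v _)); rewrite ?mem_iota.
pose e := induced_digraph (list_digraph n.+1 arcs) (~: colour_class n.+1 col k).
have eE i j : i < 12 -> j < 12 -> e (h i) (h j) = ((m i, m j) \in arcs).
  by move=> i12 j12; rewrite -(hE i) // -(hE j).
have uE i v : i < 12 -> underlying e (h i) v = adj arcs (m i) (val (val v)).
  by move=> i12; rewrite -(hE i).
apply: (no_CAI_partition (c := fun i : 'Z_4 => h i)
  (d := fun i : 'Z_4 => h (4 + i)) (s := fun i : 'Z_4 => h (8 + i))).
- move=> i; have [e1 e2 e3 _ _] := mE i; rewrite modn_small // in e1 e2.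
  by split; rewrite -/e eE // ?add1 ?add2 //.
- by move=> i; have [_ _ _ e4 _] := mE i; rewrite -/e uE // hE // add1.
- move=> i v; have [_ _ _ _ e5] := mE i; rewrite -/e uE // => sv.
  have := e5 (val (val v)) (ltn_ord _) sv.
  have := valP v; rewrite !inE => /negPf ->; rewrite orFb => /orP[] /eqP ev; [left|right].
    by apply: val_inj; apply: val_inj; rewrite hE.
  by apply: val_inj; apply: val_inj; rewrite hE; [rewrite add1; exact: ev|exact: c12].
- by move=> i j /eqP; rewrite hI // => /eqP; apply: val_inj.
- by move=> i j /eqP; rewrite hI // eqn_add2l => /eqP; apply: val_inj.
- move=> i j; rewrite hI //.
  by rewrite neq_ltn (leq_trans (i4 i)) // leq_addr.
- move=> i j; rewrite hI //.
  by rewrite neq_ltn orbC (leq_trans (i4 j)) // (leq_trans _ (leq_addr _ _)).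
Qed.

(** * The gadget, its three copies and their drawing *)

(** [hub i], [mid i] and [tip i] are c_i, d_i and s_i. *)
Definition hub i := i %% 4.
Definition mid i := 4 + i %% 4.
Definition tip i := 8 + i %% 4.
Definition apex_f i := 12 + i %% 4.
Definition apex_e i := 16 + i %% 4.
Definition apex_q i := 20 + i %% 2.

(** The apexes of the faces c_i d_i s_i c_(i+1), of the faces
    d_i s_i c_(i+1) c_(i+2) and of the two faces c_i d_i c_(i+2) d_(i+2) are
    [apex_f], [apex_e] and [apex_q].  A hub receives three arcs from apexes, a
    mid vertex two and a tip none, which are their outdegrees in the core. *)
Definition gadget_arcs : seq (nat * nat) :=
  flatten [seq
    [:: (hub i, hub i.+1); (hub i, mid i); (mid i, hub i.+2);
        (mid i, tip i); (hub i.+1, tip i);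
        (apex_f i, hub i); (apex_f i, mid i);
        (tip i, apex_f i); (hub i.+1, apex_f i);
        (apex_e i, mid i); (apex_e i, hub i.+1);
        (tip i, apex_e i); (hub i.+2, apex_e i);
        (apex_q i, hub i); (mid i, apex_q i)] | i <- iota 0 4].

Definition pyramid (z : nat) (a b c d : nat) : seq (nat * nat * nat) :=
  [:: (a, b, z); (b, c, z); (c, d, z); (d, a, z)].

Definition gadget_faces : seq (nat * nat * nat) :=
  flatten [seq
    pyramid (apex_f i) (hub i) (mid i) (tip i) (hub i.+1) ++
    pyramid (apex_e i) (mid i) (tip i) (hub i.+1) (hub i.+2)
    | i <- iota 0 4] ++
  flatten [seq
    pyramid (apex_q i) (hub i) (mid i) (hub i.+2) (mid i.+2)
    | i <- iota 0 2].

(** Gluing a copy along its directed facial triangle [apex_f 0], [hub 0],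
    [hub 1], numbered 12, 0 and 1; its other vertices are numbered from [base]
    on. *)
Definition glued (f c0 c1 base j : nat) : nat :=
  if j == 12 then f else if j == 0 then c0 else if j == 1 then c1
  else if j < 12 then base + (j - 2) else base + (j - 3).

(** The first copy receives the others on its directed facial triangles
    [hub 0], [hub 1], [apex_f 0] and [hub 3], [apex_f 2], [hub 2], in such a way
    that the vertex meeting the apex of the new copy is [hub 0] and [hub 3],
    one from each colour class of the core. *)
Definition copy (k : nat) : nat -> nat :=
  nth id [:: id; glued 0 1 12 22; glued 3 14 2 41] k.

Definition arcs : seq (nat * nat) :=
  undup (flatten [seq [seq (copy k a.1, copy k a.2) | a <- gadget_arcs]
                 | k <- iota 0 3]).

(** Part 0 consists of the apexes; [hub i] and [tip i] are in the same colour
    class of the core, which alternates with [i], and [mid i] is in the other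
    one. *)
Definition role (j : nat) : nat :=
  if 12 <= j then 0 else if odd (j + j %/ 4) then 2 else 1.

(** [loc] inverts the numbering of [glued]; each copy shifts the roles of the
    first one, so that its apexes get colours 0, 1 and 2 respectively. *)
Definition colour (v : nat) : nat :=
  let loc b := let j := v - b + 2 in if j < 12 then j else j.+1 in
  if v < 22 then role v
  else if v < 41 then (role (loc 22)).+1 %% 3
  else (role (loc 41)).+2 %% 3.

Definition coordinates : seq (nat * nat) :=
  [:: (150,0); (46,71); (3,93); (82,9); (21,121); (57,45); (0,0); (78,33);
     (34,96); (32,68); (37,5); (111,18); (50,90); (36,71); (11,12);
     (101,12); (20,95); (52,43); (87,2); (85,40); (0,150); (68,37);
     (93,46); (64,65); (116,25); (62,73); (80,51); (55,77); (116,29);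
     (77,61); (69,59); (51,74); (66,73); (80,53); (56,70); (90,51);
     (72,62); (59,64); (50,81); (95,40); (57,78); (40,37); (20,37);
     (58,15); (16,62); (33,21); (11,58); (56,32); (27,50); (25,28);
     (12,36); (17,68); (32,33); (15,35); (36,50); (25,43); (19,21); (8,60);
     (43,20); (12,65)].

Definition points : seq (Z * Z) := Eval vm_compute in
  [seq (BinInt.Z.of_nat a.1, BinInt.Z.of_nat a.2) | a <- coordinates].

Definition position (v : nat) : Z * Z := nth (BinNums.Z0, BinNums.Z0) points v.

Definition outer : nat * nat * nat := (6, 0, 20).

(** The two gluing triangles are not faces any more, and occur in one
    orientation in each of the two copies that share them. *)
Definition faces : seq (nat * nat * nat) :=
  let all_faces := flatten [seq [seq (copy k t.1.1, copy k t.1.2, copy k t.2)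
                                | t <- gadget_faces] | k <- iota 0 3] in
  [seq (if (0 < orientation position t.1.1 t.1.2 t.2)%R then t
        else (t.1.2, t.1.1, t.2))
  | t <- all_faces
    & t \notin [:: (1, 0, 12); (12, 1, 0); (3, 2, 14); (2, 14, 3); outer]].

Lemma arcs_oriented : all (fun a => flip a \notin arcs) arcs.
Proof. by vm_compute. Qed.

Lemma arcs_connected :
  all (fun v => has (adj arcs v) (iota 0 v)) (iota 1 59).
Proof. by vm_compute. Qed.

Lemma arcs_balanced :
  all (fun v => count (fun u => (u, v) \in arcs) (iota 0 60) ==
                count (fun u => (v, u) \in arcs) (iota 0 60)) (iota 0 60).
Proof. by vm_compute. Qed.

Lemma arcs_tripartition :
  tripartition_check 60 arcs colour (nth 0 [:: 12; 0; 1]).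
Proof. by vm_compute. Qed.

Lemma arcs_gadgets :
  all (fun k => gadget_check 60 arcs colour k (copy k)) (iota 0 3).
Proof. by vm_compute. Qed.

Lemma arcs_drawing :
  drawing_check 60 position (arcs ++ [seq flip a | a <- arcs]) faces outer.
Proof. by vm_compute. Qed.

Theorem theorem11 (R : realType) :
  exists (T : finType) (e : rel T),
    [/\ eulerian e, oriented_planar_triangulation R e &
        exists P : {set {set T}},
          unique (tripartition e) P /\
          forall I : {set T}, I \in P ->
            ~ exists A J : {set {x : T | x \in ~: I}},
                CAI_partition (induced_digraph e (~: I)) A J].
Proof.
exists 'I_60, (list_digraph 60 arcs); split.
- by apply: eulerian_list; [exact: arcs_connected|exact: arcs_balanced].
- split; first exact: oriented_list arcs_oriented.
  apply: drawing_checkP arcs_drawing => u v.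
  rewrite underlying_list /adj mem_cat; congr orb.
  apply/idP/mapP => [vu|[[a b] ab [-> ->]] //].
  by exists (val v, val u).
- exists (colour_classes 60 colour); split.
    exact: tripartition_list arcs_tripartition.
  move=> I /imsetP[k _ ->]; apply: gadget_no_CAI.
  by apply: (allP arcs_gadgets); rewrite mem_iota /=.
Qed.
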